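(* Let $\beta>1$ be a Pisot number, let $m>\beta$ be an integer, let $\mu=\mu_{\beta,m}$, and let $\gamma=\gamma(\beta,m)>0$ be the constant such that $\lim_{n\to\infty}\frac1n\log\mathcal N_n(x;\beta)=\gamma$ for Lebesgue-a.e. $x\in I_\beta$. Then for Lebesgue-a.e. $x\in I_\beta$ the local dimension $d(\mu_{\beta,m},x)$ exists and $$d(\mu_{\beta,m},x)=\frac{\log m-\gamma}{\log\beta}.$$
   Context: A Pisot number is an algebraic integer $\beta>1$ all of whose other Galois conjugates have modulus strictly less than $1$ (rational integers $\beta\ge2$ are included). For a real $\beta>1$ and an integer $m>\beta$, put $I_\beta=[0,\frac{m-1}{\beta-1}]$. For $x\in I_\beta$ let $\mathcal E_n(x;\beta)$ be the set of words $(\varepsilon_1,\dots,\varepsilon_n)\in\{0,1,\dots,m-1\}^n$ for which there exists $(\varepsilon_{n+1},\varepsilon_{n+2},\dots)\in\{0,1,\dots,m-1\}^{\mathbb N}$ with $x=\sum_{k=1}^\infty\varepsilon_k\beta^{-k}$, and let $\mathcal N_n(x;\beta)=\#\mathcal E_n(x;\beta)$. For $\beta$ Pisot, a constant $\gamma>0$ as in the claim exists (and is clearly unique); this is what $\gamma(\beta,m)$ denotes. The measure $\mu_{\beta,m}$ is the Borel probability measure on $\mathbb R$ given by $\mu_{\beta,m}(E)=\mathbb P\{(\varepsilon_1,\varepsilon_2,\dots)\in\{0,1,\dots,m-1\}^{\mathbb N}:\sum_{k=1}^\infty\varepsilon_k\beta^{-k}\in E\}$, where $\mathbb P$ is the infinite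 product of the uniform probability measures $\{1/m,\dots,1/m\}$ on $\{0,\dots,m-1\}$. The local dimension of $\mu$ at $x$ is $d(\mu,x)=\lim_{r\to0}\frac{\log\mu([x-r,x+r])}{\log r}$, provided the limit exists. *)

(* Defs.v *)
From HB Require Import structures.
From mathcomp Require Import all_boot all_order all_algebra.
From mathcomp Require Import complex.
From mathcomp Require Import all_classical all_reals all_analysis.
From mathcomp Require Import measurable_realfun.

Set Implicit Arguments.
Unset Strict Implicit.
Unset Printing Implicit Defensive.

Import Order.TTheory GRing.Theory Num.Theory.
Import numFieldNormedType.Exports.

Local Open Scope classical_set_scope.
Local Open Scope ring_scope.

Section pisot.
Variable R : realType.

Definition galois_conjugate (x : R) (z : R[i]) : Prop :=
  exists p : {poly rat}, [/\ irreducible_poly p,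
    root (map_poly ratr p) x & root (map_poly ratr p) z].

Definition pisot (beta : R) : Prop :=
  [/\ 1 < beta, integralOver (intr : int -> R) beta
    & forall z : R[i], galois_conjugate beta z -> z != beta%:C%C -> `|z| < 1].

Lemma pisot_gt1 (beta : R) : pisot beta -> 1 < beta.
Proof. by case. Qed.

End pisot.

Section digit_expansions.
Variables (R : realType) (beta : R) (m : nat).

Definition expansion_interval : set R :=
  `[0, (m%:R - 1) / (beta - 1)]%classic.

Definition expansion_series (e : nat -> 'I_m) : R^nat :=
  series (fun k => (e k)%:R / beta ^+ k.+1).

(* Digit number k+1 of the usual 1-based indexing is [e k]. *)
Definition expansion (e : nat -> 'I_m) : R := limn (expansion_series e).

Definition expansion_prefixes (n : nat) (x : R) : {set n.-tuple 'I_m} :=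
  [set w | `[< exists e : nat -> 'I_m,
                 (forall i : 'I_n, e i = tnth w i) /\ x = expansion e >]].

Definition count_prefixes (n : nat) (x : R) : nat :=
  #|expansion_prefixes n x|.

Lemma digits_gt0 : 1 < beta -> beta < m%:R -> (0 < m)%N.
Proof.
by move=> b1 bm; rewrite -(ltr_nat R) (lt_trans _ bm)// (lt_trans _ b1).
Qed.

Lemma is_cvg_expansion_series (e : nat -> 'I_m) : 1 < beta ->
  cvgn (expansion_series e).
Proof.
move=> b1; have b0 : 0 < beta by rewrite (lt_trans _ b1).
have bV0 : 0 <= beta^-1 by rewrite invr_ge0 ltW.
apply: (@series_le_cvg _ _ (geometric (m%:R / beta) beta^-1)).
- by move=> k; rewrite divr_ge0 ?ler0n// exprn_ge0// ltW.
- by move=> k; rewrite /= mulr_ge0 ?exprn_ge0// mulr_ge0 ?ler0n.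
- move=> k /=; rewrite exprS invfM mulrA exprVn.
  rewrite ler_wpM2r ?invr_ge0 ?exprn_ge0 ?(ltW b0)//.
  by rewrite ler_wpM2r// ler_nat ltnW.
- apply: is_cvg_geometric_series.
  by rewrite ger0_norm// invf_lt1.
Qed.

End digit_expansions.

Section digit_sequences.
Variables (m : nat) (m_gt0 : (0 < m)%N).

(* The proof of [0 < m] provides the point required by [measurableType]. *)
Definition digit_seq of (0 < m)%N := nat -> 'I_m.

HB.instance Definition _ := gen_eqMixin (digit_seq m_gt0).
HB.instance Definition _ := gen_choiceMixin (digit_seq m_gt0).
HB.instance Definition _ :=
  isPointed.Build (digit_seq m_gt0) (fun=> Ordinal m_gt0).

Definition coordinate_events : set (set (digit_seq m_gt0)) :=
  [set C | exists k (A : {set 'I_m}), C = [set e | e k \in A]].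

Definition digit_space := g_sigma_algebraType coordinate_events.
HB.instance Definition _ := Measurable.on digit_space.

Variable R : realType.

Definition is_uniform_product (P : probability digit_space R) : Prop :=
  forall (n : nat) (A : nat -> {set 'I_m}),
    P [set e | forall k, (k < n)%N -> e k \in A k] =
    (\prod_(k < n) (#|A k|%:R / m%:R))%:E.

Lemma measurable_coordinate (k : nat) (A : {set 'I_m}) :
  measurable ([set e | e k \in A] : set digit_space).
Proof. by apply: sub_sigma_algebra; exists k, A. Qed.

End digit_sequences.

(* Existence of the product measure: it is the law of the sequence of base-[m]
   digits of a uniform random point of [0, 1[. *)
Section uniform_product_exists.
Variables (R : realType) (m : nat) (m_gt0 : (0 < m)%N).

Let mR := m%:R : R.

Let mR_gt0 : 0 < mR.
Proof. by rewrite ltr0n. Qed.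

Let mRX_gt0 n : 0 < mR ^+ n.
Proof. by rewrite exprn_gt0. Qed.

Definition base_digits (u : measurableTypeR R) : digit_space m_gt0 :=
  fun k => Ordinal (ltn_pmod (Num.truncn (u * m%:R ^+ k.+1)) m_gt0).

Let measurable_truncn_lt (c : R) (j : nat) : 0 < c ->
  measurable ([set u | (Num.truncn (u * c) < j)%N] : set (measurableTypeR R)).
Proof.
move=> c0; case: j => [|j].
  by rewrite (_ : [set _ | _] = set0) ?measurable0//; apply/seteqP; split.
rewrite (_ : [set _ | _] = `]-oo, (j.+1%:R / c)[%classic)//.
by apply/seteqP; split => u /=; rewrite in_itv/= ltr_pdivlMr// ltnS truncn_le_nat.
Qed.

Let measurable_truncn (c : R) (j : nat) : 0 < c ->
  measurable ([set u | Num.truncn (u * c) = j] : set (measurableTypeR R)).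
Proof.
move=> c0; rewrite (_ : [set _ | _] =
  [set u | (Num.truncn (u * c) < j.+1)%N] `\`
  [set u | (Num.truncn (u * c) < j)%N]).
  by apply: measurableD; exact: measurable_truncn_lt.
apply/seteqP; split => u /=; first by move=> ->; rewrite ltnn ltnS leqnn.
by case=> h1 h2; apply/eqP; rewrite eqn_leq -ltnS h1/= leqNgt; apply/negP.
Qed.

Let measurable_base_digits : measurable_fun [set: _] base_digits.
Proof.
apply: (@measurability _ _ _ (digit_space m_gt0) setT base_digits
  (@coordinate_events _ m_gt0)) => //.
move=> _ [_ [k [A ->]] <-]; rewrite setTI.
rewrite (_ : _ @^-1` _ = \bigcup_(j in [set j | Ordinal (ltn_pmod j m_gt0) \in A])
  [set u | Num.truncn (u * mR ^+ k.+1) = j]).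
  by apply: bigcup_measurable => j _; exact: measurable_truncn.
apply/seteqP; split => u /=.
  by move=> uA; exists (Num.truncn (u * mR ^+ k.+1)).
by case=> j jA uj; rewrite /base_digits uj.
Qed.

HB.instance Definition _ := isMeasurableFun.Build _ _ _ _
  base_digits measurable_base_digits.

Let measurable_unit_itv : measurable (`[0, 1[%classic : set (measurableTypeR R)).
Proof. exact: measurable_itv. Qed.

Definition unit_lebesgue : set (measurableTypeR R) -> \bar R :=
  mrestr lebesgue_measure measurable_unit_itv.

HB.instance Definition _ := Measure.on unit_lebesgue.

Let unit_lebesgue_setT : unit_lebesgue setT = 1%E.
Proof.
rewrite /unit_lebesgue /mrestr setTI.
have /= -> := @lebesgue_measure_itv R `[0, 1[.
by rewrite lte_fin ltr01 sube0.
Qed.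

HB.instance Definition _ := Measure_isProbability.Build _ _ _
  unit_lebesgue unit_lebesgue_setT.

Let cylinder n (w : {ffun 'I_n -> 'I_m}) : set (digit_space m_gt0) :=
  [set e | forall k : 'I_n, e k = w k].

Let measurable_cylinder n (w : {ffun 'I_n -> 'I_m}) : measurable (cylinder w).
Proof.
rewrite (_ : cylinder w =
    \bigcap_(k in [set: 'I_n]) [set e | e k \in [set w k]%SET]).
  by apply: fin_bigcap_measurable => // k _; exact: measurable_coordinate.
apply/seteqP; split => e /= h k; first by rewrite /= inE h.
by have := h k Logic.I; rewrite /= inE => /eqP.
Qed.

Let truncn_divn (x : R) : 0 <= x -> Num.truncn x = (Num.truncn (x * mR) %/ m)%N.
Proof.
move=> x0; have xm0 : 0 <= x * mR by rewrite mulr_ge0// ltW.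
apply/eqP; rewrite truncn_eq//; set N := Num.truncn (x * mR).
have /andP[h1 h2] := truncn_itv xm0.
apply/andP; split.
- rewrite -(ler_pM2r mR_gt0) (le_trans _ h1)// -natrM ler_nat.
  exact: leq_divM.
- rewrite -(ltr_pM2r mR_gt0) (lt_le_trans h2)// -natrM ler_nat.
  by rewrite -ltn_divLR//.
Qed.

Let code (w : nat -> 'I_m) : nat -> nat :=
  fix code n := if n is n'.+1 then (code n' * m + w n')%N else 0%N.

Let codeP (w : nat -> 'I_m) n (u : R) : 0 <= u < 1 ->
  (forall k, (k < n)%N -> base_digits u k = w k) <->
  Num.truncn (u * mR ^+ n) = code w n.
Proof.
move=> /andP[u0 u1]; elim: n => [|n IHn].
  split=> // _; rewrite expr0 mulr1 /=; apply/eqP; rewrite truncn_eq// u0/=.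
  by [].
have un0 : 0 <= u * mR ^+ n by rewrite mulr_ge0// ltW.
have E := truncn_divn un0; rewrite -mulrA -exprSr in E.
rewrite /=; split.
  move=> H; have En : Num.truncn (u * mR ^+ n) = code w n.
    by apply: IHn.1 => k kn; apply: H; rewrite ltnS ltnW.
  rewrite (divn_eq (Num.truncn (u * mR ^+ n.+1)) m) -E En; congr addn.
  by have /(congr1 val) := H n (leqnn _).
move=> H; rewrite H divnMDl// (divn_small (ltn_ord _)) addn0 in E.
move=> k; rewrite ltnS leq_eqVlt => /orP[/eqP ->|kn]; last exact: (IHn.2 E).
by apply: val_inj => /=; rewrite H modnMDl modn_small.
Qed.

Let code_lt (w : nat -> 'I_m) n : (code w n < m ^ n)%N.
Proof.
elim: n => [|n IHn] //=; rewrite expnSr.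
rewrite (@leq_trans ((code w n).+1 * m)) ?leq_mul2r ?IHn ?orbT//.
by rewrite mulSn addnC ltn_add2r.
Qed.

Let unit_lebesgue_cylinder n (w : {ffun 'I_n -> 'I_m}) :
  distribution unit_lebesgue base_digits (cylinder w) = ((mR ^+ n)^-1)%:E.
Proof.
pose v k := if insub k is Some i then w i else Ordinal m_gt0.
have vE (k : 'I_n) : v k = w k by rewrite /v valK.
have cE : base_digits @^-1` cylinder w `&` `[0, 1[%classic =
    `[(code v n)%:R / mR ^+ n, (code v n).+1%:R / mR ^+ n[%classic.
  apply/seteqP; split => u /=.
    case=> H; rewrite in_itv/= => u01.
    have : Num.truncn (u * mR ^+ n) = code v n.
      by apply: (codeP v n u01).1 => k kn; rewrite (H (Ordinal kn)) -vE.
    move/eqP; rewrite truncn_eq; last by case/andP: u01 => *; rewrite mulr_ge0// ltW.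
    by rewrite in_itv/= ler_pdivrMr// ltr_pdivlMr.
  rewrite in_itv/= ler_pdivrMr// ltr_pdivlMr// => H.
  have u01 : 0 <= u < 1.
    case/andP: H => h1 h2; rewrite -(pmulr_lge0 _ (mRX_gt0 n)).
    rewrite (le_trans _ h1)//= -(ltr_pM2r (mRX_gt0 n)) mul1r (lt_le_trans h2)//.
    by rewrite -natrX ler_nat code_lt.
  split; last by rewrite in_itv.
  move=> k; rewrite -vE; apply: (codeP v n u01).2 => //.
  apply/eqP; rewrite truncn_eq//.
  by case/andP: u01 => *; rewrite mulr_ge0// ltW.
rewrite /distribution /pushforward /= /unit_lebesgue /mrestr cE.
rewrite lebesgue_measure_itv /= lte_fin ltr_pM2r ?invr_gt0// ltr_nat ltnSn.
by rewrite -EFinB -mulrBl -natrB// subSnn mul1r.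
Qed.

Lemma uniform_product_exists :
  exists P : probability (digit_space m_gt0) R, is_uniform_product P.
Proof.
exists (distribution unit_lebesgue base_digits) => n A.
pose F := [set w : {ffun 'I_n -> 'I_m} | [forall k, w k \in A k]]%SET.
rewrite (_ : [set e | _] = \bigcup_(w in [set` F]) cylinder w); last first.
  apply/seteqP; split => e /=.
    move=> H; exists [ffun k : 'I_n => e k]; last by move=> k; rewrite ffunE.
    by rewrite /= inE; apply/forallP => k; rewrite ffunE; exact: H.
  case=> w /=; rewrite inE => /forallP wA H k kn.
  by rewrite (H (Ordinal kn)); exact: (wA (Ordinal kn)).
rewrite measure_fin_bigcup//; first last.
  apply/trivIsetP => w w' _ _ /eqP ww'.
  apply/seteqP; split => // e [/= H1 H2]; apply: ww'.
  by apply/ffunP => k; rewrite -H1 -H2.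
rewrite (eq_fsbigr (fun=> ((mR ^+ n)^-1)%:E)); last first.
  by move=> w _; exact: unit_lebesgue_cylinder.
rewrite -(@bigfs _ _ _ _ (index_enum _) (mem F)) ?index_enum_uniq//; last first.
  by move=> w _; rewrite mem_index_enum.
rewrite sumEFin; congr EFin.
rewrite big_split/= prodr_const card_ord exprVn sumr_const -natr_prod -[LHS]mulr_natl.
congr (_%:R * _).
rewrite (_ : #|F| = #|family (fun k : 'I_n => mem (A k))|).
  by rewrite card_family foldrE big_map big_enum.
by apply: eq_card => w; rewrite inE.
Qed.

End uniform_product_exists.

Section bernoulli_convolution.
Variables (R : realType) (m : nat) (m_gt0 : (0 < m)%N).

Definition uniform_product : probability (digit_space m_gt0) R :=
  sval (cid (uniform_product_exists R m_gt0)).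

Lemma uniform_productP : is_uniform_product uniform_product.
Proof. exact: svalP (cid (uniform_product_exists R m_gt0)). Qed.

Variable beta : R.
Hypothesis beta_gt1 : 1 < beta.

(* The hypothesis [1 < beta] ensures convergence, hence measurability. *)
Definition random_expansion of 1 < beta :
  digit_space m_gt0 -> measurableTypeR R := fun e => expansion beta e.

Let measurable_random_expansion :
  measurable_fun [set: digit_space m_gt0] (random_expansion beta_gt1).
Proof.
apply: (@measurable_fun_cvg _ (digit_space m_gt0) R setT
  (fun n (e : digit_space m_gt0) => expansion_series beta e n)).
- move=> n; rewrite /expansion_series /series /=.
  apply: measurable_sum => k; apply: measurable_funM => //.
  move=> _ Y _; rewrite setTI.
  rewrite (_ : _ @^-1` Y =
      [set e | e k \in [set a : 'I_m | `[< Y (a%:R : R) >]]%SET]).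
    exact: measurable_coordinate.
  by apply/seteqP; split => e /=; rewrite inE => /asboolP.
- move=> e _; exact: is_cvg_expansion_series.
Qed.

HB.instance Definition _ := isMeasurableFun.Build _ _ _ _
  (random_expansion beta_gt1) measurable_random_expansion.

End bernoulli_convolution.

Section main_notions.
Variable R : realType.

Definition bernoulli_convolution (beta : R) (m : nat) (beta_gt1 : 1 < beta)
    (m_gt_beta : beta < m%:R) : probability (measurableTypeR R) R :=
  distribution (uniform_product R (digits_gt0 beta_gt1 m_gt_beta))
    (random_expansion beta_gt1).

(* [lne 0 = -oo], so the quotient is [+oo] when the interval is [mu]-null and
   [r < 1]. *)
Definition has_local_dimension (mu : {measure set (measurableTypeR R) -> \bar R})
    (x : R) (d : \bar R) : Prop :=
  (lne (mu `[(x - r)%R, (x + r)%R]%classic) * ((ln r)^-1)%:E)%E @[r --> 0^'+] --> d.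

End main_notions.

(* Main.v *)
Require Import Defs.
From mathcomp Require Import all_boot all_order all_algebra.
From mathcomp Require Import complex.
From mathcomp Require Import all_classical all_reals all_analysis.
From mathcomp Require Import measurable_realfun.
From mathcomp Require Import ring lra.

Set Implicit Arguments.
Unset Strict Implicit.
Unset Printing Implicit Defensive.

Import Order.TTheory GRing.Theory Num.Theory.
Import numFieldNormedType.Exports.

Local Open Scope classical_set_scope.
Local Open Scope ring_scope.

(** Write [S(w)] for the digit sum of a word [w] of length [n], and
    [L = (m - 1) / (beta - 1)] for the length of the expansion interval.  As
    [m > beta], every point of [[0, L]] has an expansion, so [w] is a prefix of
    an expansion of [x] exactly when [S(w) <= x <= S(w) + L / beta ^ n]
    ([expansion_prefixesP]).  A random expansion starts with [w] with probability
    [m ^ -n], whence two bounds at scale [beta ^ -n]: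
    - a ball of radius [L / beta ^ n] at [x] has mass at least
      [N_n(x) / m ^ n] ([bernoulli_ball_ge]);
    - a ball of radius [beta ^ -n] at [x] has mass at most [m ^ -n] times the
      number of words with [S(w)] within [(L + 1) / beta ^ n] of [x]
      ([bernoulli_ball_le]).
    The first bound gives the upper estimate of the dimension at once.  For the
    lower estimate one has to know that the words near [x] are not much more
    numerous than [exp (n gamma)], for almost every [x].

    Here the Pisot property enters, through Garsia's separation lemma
    ([pisot_separation]): the distinct values of [S] on words of length [n] are
    at least [c / beta ^ n] apart.  Hence boundedly many values lie near [x],
    and it suffices to bound how many words share a value [p].  Such words are
    all counted by [N_n(y)] for every [y] in [[p, p + L / beta ^ n]]
    ([card_near_words]), so it suffices to find one point [y] in that interval
    where [N_n(y)] is under control.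

    Pointwise growth at [x] says nothing about neighbours of [x], and no rate is
    available for a Borel-Cantelli argument.  Lebesgue's density theorem does
    the job instead: almost every [x] is a density point of a set of points [y]
    with [N_n(y) <= exp (n (gamma + eps))] for all [n >= n0], and such a set
    meets every interval near [x] whose length is comparable to its distance to
    [x] ([density_point_meets], [near_words_growth]).

    The two bounds differ from [exp (n gamma) / m ^ n] by a factor
    [exp (O (n eps) + O (1))], and comparing a radius [r] with the powers of
    [beta] turns them into the limit of the quotient of logarithms
    ([cvg_ln_ratio]). *)

(** * Garsia separation *)

(** Factor [P] into linear terms: each factor [A - a] has determinant
    [char_poly A] at [a] up to sign, and exchanging the two products over the
    roots of [P] and over the eigenvalues gives the values of [P].  Applied to a
    companion matrix, this is the resultant of two polynomials, and it shows
    that a product of conjugates is an integer. *)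
Lemma det_horner_mx (F : closedFieldType) (n : nat) (A : 'M[F]_n.+1)
    (P : {poly F}) (s : seq F) :
  char_poly A = \prod_(z <- s) ('X - z%:P) ->
  \det (horner_mx A P) = \prod_(z <- s) P.[z].
Proof.
move=> sE; have ss : size s = n.+1.
  by have := size_char_poly A; rewrite sE size_prod_XsubC => -[].
have detB a : \det (A - a%:M) = \prod_(z <- s) (z - a).
  have -> : A - a%:M = - (a%:M - A) by rewrite opprB.
  rewrite -scaleN1r detZ.
  have -> : \det (a%:M - A) = (char_poly A).[a].
    rewrite -horner_evalE -det_map_mx; congr (\det _).
    apply/matrixP => i j; rewrite !mxE rmorphB rmorphMn /= /horner_eval.
    by rewrite hornerX hornerC.
  rewrite sE horner_prod -ss.
  elim: (s) => [|z t IH]; first by rewrite !big_nil mulr1.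
  by rewrite !big_cons /= -IH exprS hornerXsubC; ring.
have [r ->] := closed_field_poly_normal P.
rewrite linearZ /= detZ rmorph_prod /=.
under eq_bigr do rewrite rmorphB /= horner_mx_X horner_mx_C.
have -> : \det (\prod_(i <- r) (A - i%:M)) = \prod_(i <- r) \det (A - i%:M).
  by elim: r => [|a r IH]; rewrite !(big_nil, big_cons) ?det1// -IH -det_mulmx.
under eq_bigr do rewrite detB.
rewrite exchange_big /=.
under [RHS]eq_bigr do rewrite hornerZ horner_prod.
rewrite -ss; set c := lead_coef P.
elim: s {sE ss detB} => [|z t IH]; first by rewrite !big_nil mulr1.
rewrite !big_cons -IH /= exprS.
under [X in _ = c * X * _]eq_bigr do rewrite hornerXsubC.
by ring.
Qed.

Lemma map_poly_ratr_int (F : numFieldType) (p : {poly int}) :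
  map_poly ratr (map_poly intr p : {poly rat}) = map_poly intr p :> {poly F}.
Proof.
by rewrite -map_poly_comp; apply: eq_map_poly => z /=; rewrite ratr_int.
Qed.

(** Gauss's lemma: a rational polynomial of least degree vanishing at [x]
    divides the integral polynomial that witnesses integrality, hence is
    proportional to an integral polynomial whose leading coefficient is a unit
    of the integers. *)
Lemma exists_minimal_poly (R : realType) (x : R) :
  integralOver (intr : int -> R) x ->
  exists p : {poly int}, [/\ p \is monic,
    irreducible_poly (map_poly intr p : {poly rat}) &
    root (map_poly intr p) x].
Proof.
move=> [q qm qx].
pose q' : {poly rat} := map_poly intr q.
pose has_root (n : nat) := `[< exists r : {poly rat},
   [/\ r != 0, root (map_poly ratr r) x & size r = n] >].
have mapQ := @map_poly_ratr_int R.
have q'0 : q' != 0 by apply: monic_neq0; rewrite monic_map.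
have exn : exists n, has_root n.
  by exists (size q'); apply/asboolP; exists q'; split=> //; rewrite mapQ.
case: (ex_minnP exn) => n /asboolP[r [r0 rx rn]] rmin.
have minr (d : {poly rat}) : d != 0 -> root (map_poly ratr d) x ->
    (size r <= size d)%N.
  by move=> d0 dx; rewrite rn; apply: rmin; apply/asboolP; exists d.
have rirr : irreducible_poly r.
  split.
    rewrite ltnNge; apply/negP => /size1_polyC rC; move: rx r0.
    by rewrite rC map_polyC rootC fmorph_eq0 polyC_eq0 => ->.
  move=> d d1 /dvdpP[e rE].
  have d0 : d != 0 by apply: contraNneq r0 => d0; rewrite rE d0 mulr0.
  have e0 : e != 0 by apply: contraNneq r0 => e0; rewrite rE e0 mul0r.
  have dr : d %| r by rewrite rE dvdp_mull.
  move: (rx); rewrite rE rmorphM rootM => /orP[ex|dx].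
    have := minr _ e0 ex; rewrite rE size_mul//.
    move: d1; rewrite -(size_poly_gt0 d) in d0; move: d0.
    case: (size d) => [|[|k]]// _ _.
    by rewrite !addnS /= ltnNge leq_addr.
  by rewrite -rE -dvdp_size_eqp// eqn_leq minr// andbT dvdp_leq.
have rq : r %| q'.
  rewrite /dvdp; apply/negPn/negP => m0.
  have mx : root (map_poly ratr (q' %% r)) x.
    have := mapQ q; rewrite -/q' {1}(divp_eq q' r) rmorphD rmorphM /= => qE.
    by move: qx; rewrite -qE /root !hornerE (eqP rx) mulr0 add0r.
  by have := minr _ m0 mx; rewrite leqNgt ltn_modp r0.
have [p1 [a a0 rE] [t qE]] := dvdpP_rat_int rq.
have lt1 : lead_coef p1 * lead_coef t = 1.
  by rewrite -lead_coefM -qE; apply/monicP.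
have ll : lead_coef p1 * lead_coef p1 = 1.
  by have /orP[/eqP ->|/eqP ->] := intUnitRing.unitzPl (etrans (mulrC _ _) lt1).
have l0 : lead_coef p1 != 0.
  by apply: contra_eq_neq lt1 => ->; rewrite mul0r.
have pr : (map_poly intr (lead_coef p1 *: p1) : {poly rat}) %= r.
  rewrite map_polyZ/= rE (eqp_trans (eqp_scale _ _)) ?intr_eq0//.
  by rewrite eqp_sym eqp_scale.
(* The leading coefficient is [1] or [-1], so scaling by it makes [p1] monic. *)
exists (lead_coef p1 *: p1); split.
- by rewrite monicE lead_coefZ ll.
- split; first by rewrite (eqp_size pr); case: rirr.
  move=> d d1; rewrite (eqp_dvdr _ pr) => dr.
  by rewrite (eqp_trans (rirr.2 _ d1 dr))// eqp_sym.
- rewrite -mapQ; move: pr; rewrite /eqp => /andP[_ /dvdpP[e ->]].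
  by rewrite rmorphM rootM rx orbT.
Qed.

Lemma companion_exists (R : comNzRingType) (p : {poly R}) :
  p \is monic -> (1 < size p)%N ->
  exists n (A : 'M[R]_n.+1), char_poly A = p.
Proof.
move=> pm ps; have := companionmxK pm; move: (companionmx p).
by case: (size p) ps => [|[|k]]//= _ A AE; exists k, A.
Qed.

(** The product of the values of [P] at the conjugates of [b] is the
    determinant of an integral matrix, and it does not vanish, because an
    irreducible [p] that does not divide [P] is coprime to it. *)
Lemma norm_ge1 (F : numClosedFieldType) (p P : {poly int}) (s : seq F) (b : F) :
  p \is monic -> irreducible_poly (map_poly intr p : {poly rat}) ->
  map_poly intr p = \prod_(z <- s) ('X - z%:P) ->
  root (map_poly intr p) b -> (map_poly intr P).[b] != 0 ->
  1 <= \prod_(z <- s) `|(map_poly intr P).[z]|.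
Proof.
move=> pm pirr ps pb Pb.
have mapQ := @map_poly_ratr_int F.
have cop : coprimep (map_poly intr p : {poly rat}) (map_poly intr P).
  rewrite /coprimep; apply/negPn/negP => g1.
  have /andP[_ pg] := pirr.2 _ g1 (dvdp_gcdl _ _).
  have /dvdpP[e eE] := dvdp_trans pg (dvdp_gcdr _ _).
  by move: Pb; rewrite -mapQ eE rmorphM /= hornerM mapQ (eqP pb) mulr0 eqxx.
have P0 z : z \in s -> (map_poly intr P).[z] != 0.
  move=> zs; rewrite -mapQ; apply: (@coprimep_root _ (map_poly intr p)).
    by rewrite -mapQ coprimep_map.
  by rewrite ps root_prod_XsubC.
have [|n [A AE]] := companion_exists pm.
  by have [] := pirr; rewrite size_map_poly_id0// intr_eq0 (monicP pm).
have : \prod_(z <- s) (map_poly intr P).[z] = (\det (horner_mx A P))%:~R.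
  rewrite -det_map_mx map_horner_mx; apply/esym/det_horner_mx.
  by rewrite -map_char_poly AE.
move=> DE; rewrite -normr_prod DE.
have : \prod_(z <- s) (map_poly intr P).[z] != 0.
  by rewrite prodf_seq_neq0; apply/allP => z zs /=; exact: P0.
rewrite DE intr_eq0 -intr_norm => d0.
by rewrite (ler_int _ 1) -gtz0_ge1 normr_gt0.
Qed.

Lemma horner_norm_le (F : numFieldType) (P : {poly int}) (M z : F) :
  (forall i, `|(P`_i)%:~R| <= M) -> `|z| < 1 ->
  `|(map_poly intr P).[z]| <= M / (1 - `|z|).
Proof.
move=> PM z1; have M0 : 0 <= M by exact: le_trans (PM 0%N).
rewrite horner_coef; set n := size _.
apply: (le_trans (ler_norm_sum _ _ _)).
apply: (@le_trans _ _ (\sum_(i < n) M * `|z| ^+ i)).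
  by apply: ler_sum => i _; rewrite normrM normrX ler_wpM2r ?exprn_ge0// coef_map PM.
rewrite -mulr_sumr ler_wpM2l// -[leRHS]mul1r ler_pdivlMr ?subr_gt0//.
rewrite mulrC -(opprB `|z|) mulNr -subrX1 opprB gerBl exprn_ge0//.
Qed.

(** Garsia's separation lemma.  The product of [P] over all conjugates of [beta]
    has modulus at least [1], while at a conjugate [z] inside the unit disc the
    value of [P] is at most [M / (1 - |z|)]; so the remaining factor [P(beta)]
    cannot be small.  The bound depends on [M] but not on the degree of [P]. *)
Lemma pisot_separation (R : realType) (beta : R) (M : nat) :
  pisot beta ->
  exists2 c : R, 0 < c & forall P : {poly int},
    (forall i, `|P`_i| <= M%:Z) -> (map_poly intr P).[beta] != 0 ->
    c <= `|(map_poly intr P).[beta]|.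
Proof.
move=> [b1 bint bconj].
have [p [pm pirr pb]] := exists_minimal_poly bint.
have mapC (q : {poly int}) : (map_poly intr q).[beta%:C%C] =
    ((map_poly intr q).[beta])%:C%C :> R[i].
  rewrite -horner_map -map_poly_comp; congr (_.[_]).
  by apply: eq_map_poly => z /=; rewrite rmorph_int.
have [s sE] := closed_field_poly_normal (map_poly intr p : {poly R[i]}).
have pCm : map_poly intr p \is @monic R[i] by rewrite monic_map.
rewrite (monicP pCm) scale1r in sE.
have pbC : root (map_poly intr p) (beta%:C%C : R[i]).
  by rewrite /root mapC (eqP pb).
have bs : beta%:C%C \in s by rewrite -root_prod_XsubC -sE.
(* [beta] may a priori be repeated among the roots; a further factor
   [|P(beta)|] is then bounded by [1], once [|P(beta)| <= 1]. *)
pose K z : R[i] := if z == beta%:C%C then 1 else 1 + M%:R / (1 - `|z|).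
have K1 z : z \in s -> 1 <= K z.
  move=> zs; rewrite /K; case: eqP => // /eqP zb.
  rewrite lerDl divr_ge0// subr_ge0 ltW// bconj//.
  exists (map_poly intr p); split; rewrite // map_poly_ratr_int//.
  by rewrite sE root_prod_XsubC.
pose t := rem beta%:C%C s.
pose Kt := \prod_(z <- t) K z.
have Kt1 : 1 <= Kt.
  rewrite /Kt big_seq; elim/big_ind : _ => // [x y x1 y1|z /mem_rem]; last exact: K1.
  by rewrite -[1]mulr1 ler_pM.
have KtE : (complex.Re Kt)%:C%C = Kt.
  by rewrite RRe_real// ger0_real// (le_trans ler01).
have Kt1' : 1 <= complex.Re Kt by rewrite -lecR KtE.
have Kt0' : 0 < complex.Re Kt by rewrite (lt_le_trans ltr01).
(* [Kt] is a positive real number that lives in [R[i]]. *)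
exists (complex.Re Kt)^-1; first by rewrite invr_gt0.
move=> P PM Pb.
set v := `|_|; have [v1|v1] := ltP 1 v.
  by rewrite (le_trans _ (ltW v1))// invf_le1.
rewrite -div1r ler_pdivrMr// -lecR rmorphM /= KtE.
have vE : v%:C%C = `|(map_poly intr P).[beta%:C%C]|.
  by rewrite mapC normc_def /= expr0n addr0 sqrtr_sqr.
have PbC : (map_poly intr P).[beta%:C%C : R[i]] != 0 by rewrite mapC fmorph_eq0.
apply: (le_trans (norm_ge1 pm pirr sE pbC PbC)).
rewrite (perm_big _ (perm_to_rem bs)) /= big_cons -vE ler_wpM2l//.
  by rewrite vE normr_ge0.
rewrite big_seq [leRHS]big_seq; apply: ler_prod => z /mem_rem zs.
rewrite normr_ge0 /=; rewrite /K; case: eqP => [->|/eqP zb].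
  by rewrite -vE -[leRHS]/(1%:C%C) lecR.
rewrite -[leLHS]add0r lerD// horner_norm_le//.
  by move=> i; rewrite -intr_norm -[M%:R]/((M%:Z)%:~R) ler_int.
apply: bconj => //.
exists (map_poly intr p); split; rewrite // map_poly_ratr_int//.
by rewrite sE root_prod_XsubC.
Qed.

(** * Digit sums and prefixes of expansions *)

Section digit_sums.
Variables (R : realType) (beta : R) (m : nat).
Hypotheses (beta_gt1 : 1 < beta) (m_gt_beta : beta < m%:R).

Let beta_gt0 : 0 < beta. Proof. exact: lt_trans beta_gt1. Qed.
Let betaX_gt0 n : 0 < beta ^+ n. Proof. exact: exprn_gt0. Qed.
Let beta1_gt0 : 0 < beta - 1. Proof. by rewrite subr_gt0. Qed.

Definition expansion_length : R := (m%:R - 1) / (beta - 1).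
Local Notation L := expansion_length.

Definition digit_sum n (w : n.-tuple 'I_m) : R :=
  \sum_(i < n) (tnth w i)%:R / beta ^+ i.+1.

Lemma expansion_length_gt1 : 1 < L.
Proof. by rewrite /L ltr_pdivlMr// mul1r ltrD2r. Qed.

Let L_gt0 : 0 < L. Proof. exact: lt_trans expansion_length_gt1. Qed.

(* [L] is the largest fixed point of the maps [y |-> beta * y - d]. *)
Let L_eq : beta * L - (m%:R - 1) = L.
Proof. by rewrite /L; field; rewrite gt_eqF. Qed.

Lemma expansion_seriesS (e : nat -> 'I_m) n :
  expansion_series beta e n.+1 = expansion_series beta e n + (e n)%:R / beta ^+ n.+1.
Proof. by rewrite /expansion_series /series /= big_nat_recr. Qed.

Lemma expansion_series0 (e : nat -> 'I_m) : expansion_series beta e 0 = 0.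
Proof. by rewrite /expansion_series /series /= big_geq. Qed.

Lemma expansion_series_digit_sum (e : nat -> 'I_m) n (w : n.-tuple 'I_m) :
  (forall i : 'I_n, e i = tnth w i) -> expansion_series beta e n = digit_sum w.
Proof.
move=> ew; rewrite /expansion_series /series /= big_mkord.
by apply: eq_bigr => i _; rewrite ew.
Qed.

Lemma expansion_series_ge0 (e : nat -> 'I_m) n : 0 <= expansion_series beta e n.
Proof.
elim: n => [|n IH]; first by rewrite expansion_series0.
by rewrite expansion_seriesS addr_ge0// divr_ge0// ltW.
Qed.

(** The right-hand side is the partial sum whose digits are all [m - 1]. *)
Lemma expansion_series_le (e : nat -> 'I_m) n :
  expansion_series beta e n <= L - L / beta ^+ n.
Proof.
elim: n => [|n IH]; first by rewrite expansion_series0 expr0 divr1 subrr.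
rewrite expansion_seriesS (le_trans (lerD IH (lexx _)))// -lerBrDl.
have -> : L - L / beta ^+ n.+1 - (L - L / beta ^+ n) = (beta * L - L) / beta ^+ n.+1.
  by rewrite exprS; field; rewrite !gt_eqF.
have -> : beta * L - L = m%:R - 1 by rewrite -[X in _ - X]L_eq; ring.
rewrite ler_pM2r ?invr_gt0// lerBrDr natr1 ler_nat.
exact: ltn_ord.
Qed.

Lemma expansion_bounds (e : nat -> 'I_m) : 0 <= expansion beta e <= L.
Proof.
have cv := is_cvg_expansion_series beta_gt1 (e := e).
apply/andP; split.
  by apply: limr_ge => //; near=> n; exact: expansion_series_ge0.
apply: limr_le => //; near=> n; rewrite (le_trans (expansion_series_le _ _))//.
by rewrite gerBl divr_ge0// ltW.
Unshelve. all: by end_near. Qed.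

Lemma expansion_split (e : nat -> 'I_m) n :
  expansion beta e = expansion_series beta e n +
    expansion beta (fun k => e (n + k)%N) / beta ^+ n.
Proof.
set e' := fun k => _.
have cv := is_cvg_expansion_series beta_gt1 (e := e).
have cv' := is_cvg_expansion_series beta_gt1 (e := e').
have E k : expansion_series beta e (k + n)%N =
    expansion_series beta e n + expansion_series beta e' k / beta ^+ n.
  elim: k => [|k IH]; first by rewrite add0n expansion_series0 mul0r addr0.
  rewrite addSn !expansion_seriesS IH /e' (addnC n) mulrDl addrA; congr (_ + _).
  by rewrite -mulrA -invfM -exprD addSn.
apply/cvg_lim => //; rewrite -(cvg_shiftn n) /=.
under eq_fun do rewrite E.
by apply: cvgD; [exact: cvg_cst | apply: cvgMl; exact: cv'].
Qed.

Lemma expansion_digit_sum (e : nat -> 'I_m) n (w : n.-tuple 'I_m) :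
  (forall i : 'I_n, e i = tnth w i) ->
  digit_sum w <= expansion beta e <= digit_sum w + L / beta ^+ n.
Proof.
move=> ew; rewrite (expansion_split e n) (expansion_series_digit_sum ew).
have /andP[h0 h1] := expansion_bounds (fun k => e (n + k)%N).
by rewrite lerDl lerD2l divr_ge0 ?(ltW (betaX_gt0 _))//= ler_pM2r ?invr_gt0.
Qed.

Let m_gt0 : (0 < m)%N. Proof. exact: digits_gt0 m_gt_beta. Qed.

(** One step of the greedy algorithm: take the integer part of [beta * y], capped
    at [m - 1].  Without the cap the remainder is less than [1], and [1 < L]
    because [beta < m]. *)
Lemma next_digit (y : R) : 0 <= y <= L ->
  exists d : 'I_m, 0 <= beta * y - d%:R <= L.
Proof.
move=> /andP[y0 yL]; have by0 : 0 <= beta * y by rewrite mulr_ge0// ltW.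
have /andP[t1 t2] := truncn_itv by0.
have [tm|tm] := ltnP (Num.truncn (beta * y)) m.
  exists (Ordinal tm) => /=; rewrite subr_ge0 t1 /= lerBlDr.
  by rewrite (le_trans (ltW t2))// -natr1 addrC lerD2r ltW// expansion_length_gt1.
have m1 : (m.-1 < m)%N by rewrite prednK.
have mE : (m.-1)%:R = m%:R - 1 :> R by rewrite -subn1 natrB.
exists (Ordinal m1) => /=; rewrite mE; apply/andP; split.
  rewrite subr_ge0 (le_trans _ t1)// -mE ler_nat (leq_trans _ tm)//.
  exact: leq_pred.
by rewrite -[leRHS]L_eq lerD2r ler_pM2l.
Qed.

(** The greedy remainders stay in [[0, L]], so the error [rest n / beta ^ n]
    after [n] digits tends to [0]. *)
Lemma expansion_exists (y : R) : 0 <= y <= L ->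
  exists e : nat -> 'I_m, expansion beta e = y.
Proof.
move=> y01.
pose digit (z : R) : 'I_m :=
  if pselect (0 <= z <= L) is left h then sval (cid (next_digit h))
  else Ordinal m_gt0.
pose rest (k : nat) := iter k (fun z => beta * z - (digit z)%:R) y.
have restP k : 0 <= rest k <= L.
  elim: k => // k IH; rewrite /= -/(rest k) /digit.
  by case: pselect => // h; case: cid.
pose e k := digit (rest k).
have eE n : expansion_series beta e n = y - rest n / beta ^+ n.
  elim: n => [|n IH]; first by rewrite expansion_series0 expr0 divr1 subrr.
  rewrite expansion_seriesS IH /= -/(rest n) -/(e n) exprS.
  by field; rewrite !gt_eqF.
exists e; apply/cvg_lim => //.
rewrite (_ : expansion_series _ _ = fun n => y - rest n / beta ^+ n); last first.
  exact/funext.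
rewrite -[X in _ --> X]subr0; apply: cvgB; first exact: cvg_cst.
apply: (@squeeze_cvgr _ _ _ _ (cst 0) (fun n => L * beta^-1 ^+ n)).
- near=> n; have /andP[r0 r1] := restP n.
  by rewrite divr_ge0//= ?(ltW (betaX_gt0 _))// exprVn ler_pM2r// invr_gt0.
- exact: cvg_cst.
- rewrite -[X in _ --> X](mulr0 L); apply: cvgMr.
  by apply: cvg_expr; rewrite ger0_norm ?invr_ge0 ?ltW// invf_lt1.
Unshelve. all: by end_near. Qed.

(** A word is extendable to an expansion of [x] as soon as the rescaled
    remainder [(x - S(w)) * beta ^ n] itself has an expansion. *)
Lemma expansion_prefixesP n (x : R) (w : n.-tuple 'I_m) :
  (w \in expansion_prefixes beta m n x) =
  (digit_sum w <= x <= digit_sum w + L / beta ^+ n).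
Proof.
rewrite inE; apply/asboolP/idP => [[e [ew ->]]|]; first exact: expansion_digit_sum.
move=> /andP[x1 x2].
have [|e' e'E] := @expansion_exists ((x - digit_sum w) * beta ^+ n).
  by rewrite mulr_ge0 ?subr_ge0//= ?(ltW (betaX_gt0 _))// -ler_pdivlMr// lerBlDl.
pose e k := if insub k is Some i then tnth w i else e' (k - n)%N.
have ew (i : 'I_n) : e i = tnth w i by rewrite /e valK.
exists e; split => //; rewrite (expansion_split e n) (expansion_series_digit_sum ew).
have -> : (fun k => e (n + k)%N) = e'.
  by apply/funext => k; rewrite /e insubF ?addKn// ltnNge leq_addr.
by rewrite e'E mulfK ?gt_eqF// addrC subrK.
Qed.

End digit_sums.

(** * Counting words near a point *)

(** [beta ^ n * (S(w) - S(w'))] is a polynomial in [beta], with integral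
    coefficients bounded by [m]. *)
Lemma digit_sum_separation (R : realType) (beta : R) (m : nat) : pisot beta ->
  exists2 c : R, 0 < c & forall n (w w' : n.-tuple 'I_m),
    digit_sum beta w != digit_sum beta w' ->
    c / beta ^+ n <= `|digit_sum beta w - digit_sum beta w'|.
Proof.
move=> bp; have b0 : 0 < beta by rewrite (lt_trans ltr01)//; case: bp.
have [c c0 sep] := pisot_separation m bp; exists c => // n w w' ww'.
pose d k : int := (nth 0%N (map val w) k)%:Z - (nth 0%N (map val w') k)%:Z.
have digit_lt (u : n.-tuple 'I_m) k : (nth 0%N (map val u) k <= m)%N.
  have [ku|ku] := ltnP k (size u); last by rewrite nth_default// size_map.
  have m0 : 'I_m by move: ku; rewrite size_tuple => kn; exact: tnth u (Ordinal kn).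
  by rewrite (nth_map m0)//; exact/ltnW/ltn_ord.
have dM k : `|d k| <= m%:Z.
  rewrite /d; have := digit_lt w k; have := digit_lt w' k.
  move: (nth _ _ _) (nth _ _ _) => a b; rewrite -!lez_nat => am bm.
  have a0 : 0 <= a%:Z by []. have b0' : 0 <= b%:Z by [].
  by rewrite ler_norml; apply/andP; split; lra.
(* The first digit carries the highest power, hence the reversed index. *)
pose P : {poly int} := \poly_(i < n) d (n - i.+1)%N.
have PE : (map_poly intr P).[beta] = beta ^+ n * (digit_sum beta w - digit_sum beta w').
  rewrite /P poly_def rmorph_sum /= horner_sum -sumrB mulr_sumr.
  rewrite (reindex_inj rev_ord_inj) /=; apply: eq_bigr => i _.
  have ri : (n - (n - i.+1).+1)%N = i by exact: (congr1 val (rev_ordK i)).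
  rewrite ri map_polyZ map_polyXn /= hornerZ hornerXn.
  have ni : beta ^+ n = beta ^+ (n - i.+1) * beta ^+ i.+1.
    by rewrite -exprD subnK.
  rewrite ni /d rmorphB /= !(nth_map (tnth w i)) ?size_tuple// -!tnth_nth.
  have : beta ^+ i.+1 != 0 by rewrite expf_neq0// gt_eqF.
  by move: (beta ^+ i.+1) => Y Y0; field.
have P0 : (map_poly intr P).[beta] != 0.
  by rewrite PE mulf_neq0// ?subr_eq0// expf_neq0 ?gt_eqF.
have PM i : `|P`_i| <= m%:Z.
  by rewrite coef_poly; case: ifP => // _; rewrite normr0.
have := sep P PM P0; rewrite PE normrM (gtr0_norm (exprn_gt0 _ b0)).
by rewrite ler_pdivrMr ?exprn_gt0// mulrC.
Qed.

Lemma card_le_fibers (T : finType) (A : {set T}) (k B : nat) (f : T -> nat) :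
  (forall x, x \in A -> (f x < k)%N) ->
  (forall x, x \in A -> (#|[set y in A | f y == f x]| <= B)%N) ->
  (#|A| <= k * B)%N.
Proof.
move=> fk fB.
rewrite -sum1_card.
case: k fk => [|k] fk.
  by rewrite big1// => x /fk.
rewrite (partition_big (fun x => inord (f x) : 'I_k.+1) xpredT)//=.
rewrite -[X in (_ <= X * _)%N](card_ord k.+1) -sum_nat_const leq_sum// => i _.
rewrite sum1_card.
set S := (X in #|X|); have [x xS|/eq_card0 ->//] := pickP S.
have /andP[xA /eqP xi] : (x \in A) && (inord (f x) == i) by [].
apply: leq_trans (fB x xA); apply/subset_leq_card/fintype.subsetP => y /andP[yA /eqP yi].
rewrite inE yA /=; have := yi; rewrite -xi => /(congr1 val).
by rewrite /= !inordK ?fk// => ->.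
Qed.

(** The words of length [n] whose expansions can come within [beta ^ -n] of
    [x]. *)
Definition near_words (R : realType) (beta : R) (m n : nat) (x : R) :
    {set n.-tuple 'I_m} :=
  [set w | x - (1 + expansion_length beta m) / beta ^+ n <= digit_sum beta w
             <= x + (beta ^+ n)^-1]%SET.

(** Cut the window of [near_words] into [k] cells of length [c / beta ^ n], with
    [c] the separation constant: words in one cell have the same digit sum, and
    are therefore prefixes of the same points. *)
Lemma card_near_words (R : realType) (beta : R) (m : nat) :
  pisot beta -> beta < m%:R ->
  exists k : nat, forall n (x : R) (B : nat),
    (forall w : n.-tuple 'I_m, w \in near_words beta m n x ->
      exists2 y, digit_sum beta w <= y
          <= digit_sum beta w + expansion_length beta m / beta ^+ n &
        (count_prefixes beta m n y <= B)%N) ->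
    (#|near_words beta m n x| <= k * B)%N.
Proof.
move=> bp bm; have b1 := pisot_gt1 bp; have b0 : 0 < beta by exact: lt_trans b1.
set L := expansion_length beta m; pose D := L + 2.
have [c c0 sep] := digit_sum_separation m bp.
exists (Num.truncn (D / c)).+1 => n x B wB.
have bn0 : 0 < beta ^+ n by rewrite exprn_gt0.
pose a := x - (1 + L) / beta ^+ n.
have near_wordsE w : (w \in near_words beta m n x) =
    (a <= digit_sum beta w <= a + D / beta ^+ n).
  rewrite inE; congr (_ && (_ <= _)).
  by rewrite /a /D -/L; field; rewrite gt_eqF.
pose cell (w : n.-tuple 'I_m) := (digit_sum beta w - a) * beta ^+ n / c.
have cell_ge0 (w : n.-tuple 'I_m) : a <= digit_sum beta w -> 0 <= cell w.
  by move=> aw; rewrite /cell divr_ge0 ?mulr_ge0 ?subr_ge0// ltW.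
apply: (@card_le_fibers _ _ _ _ (fun w => Num.truncn (cell w))) => w.
  rewrite near_wordsE => /andP[aw wD]; rewrite ltnS le_truncn//.
  by rewrite /cell ler_pM2r ?invr_gt0// -ler_pdivlMr// lerBlDl.
move=> wJ; have [y wy yB] := wB w wJ.
apply: leq_trans yB; apply/subset_leq_card/fintype.subsetP => w'.
rewrite inE near_wordsE => /andP[/andP[aw' _] /eqP ww'].
rewrite expansion_prefixesP//; have -> // : digit_sum beta w' = digit_sum beta w.
apply/eqP/negPn/negP => /sep; rewrite leNgt => /negP; apply.
move: wJ; rewrite near_wordsE => /andP[aw _].
have /andP[l1 l2] := truncn_itv (cell_ge0 _ aw).
have /andP[l1' l2'] := truncn_itv (cell_ge0 _ aw').
rewrite ww' -natr1 in l1' l2'; rewrite -natr1 in l2.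
have : `|cell w' - cell w| < 1 by rewrite ltr_norml; apply/andP; split; lra.
have -> : cell w' - cell w =
    (digit_sum beta w' - digit_sum beta w) * beta ^+ n / c by rewrite /cell; ring.
have ci0 : 0 < c^-1 by rewrite invr_gt0.
rewrite !normrM (gtr0_norm bn0) (gtr0_norm ci0).
by rewrite ltr_pdivrMr// mul1r -ltr_pdivlMr.
Qed.

(** * Mass of balls *)

Section prefix_measure.
Variables (R : realType) (m : nat) (m_gt0 : (0 < m)%N).
Variable P : probability (digit_space m_gt0) R.
Hypothesis P_uniform : is_uniform_product P.

Definition prefix_events n (W : {set n.-tuple 'I_m}) : set (digit_space m_gt0) :=
  [set e | [tuple e i | i < n] \in W].

Lemma cylinderE n (w : n.-tuple 'I_m) :
  prefix_events [set w] =
  [set e | forall k, (k < n)%N -> e k \in [set nth (Ordinal m_gt0) w k]%SET].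
Proof.
apply/seteqP; split => e /=; rewrite /prefix_events /=.
  rewrite inE => /eqP ew k kn; rewrite inE -ew.
  by rewrite -[k]/(nat_of_ord (Ordinal kn)) -tnth_nth tnth_mktuple.
move=> H; rewrite inE; apply/eqP/eq_from_tnth => i.
by have := H i (ltn_ord i); rewrite inE tnth_mktuple (tnth_nth (Ordinal m_gt0)) => /eqP.
Qed.

Lemma measurable_cylinder n (w : n.-tuple 'I_m) :
  measurable (prefix_events [set w]).
Proof.
rewrite cylinderE (_ : [set e | _] =
    \bigcap_(k in `I_n) [set e | e k \in [set nth (Ordinal m_gt0) w k]%SET]).
  by apply: fin_bigcap_measurable => // k _; exact: measurable_coordinate.
by apply/seteqP; split.
Qed.

Lemma prefix_events_bigcup n (W : {set n.-tuple 'I_m}) :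
  prefix_events W = \bigcup_(w in [set` W]) prefix_events [set w].
Proof.
apply/seteqP; split => e /=.
  by move=> eW; exists [tuple e i | i < n] => //; rewrite /prefix_events /= inE.
by case=> w /= wW; rewrite /prefix_events /= inE => /eqP ->.
Qed.

Lemma measurable_prefix_events n (W : {set n.-tuple 'I_m}) :
  measurable (prefix_events W).
Proof.
rewrite prefix_events_bigcup; apply: fin_bigcup_measurable => // w _.
exact: measurable_cylinder.
Qed.

Lemma prob_prefix_events n (W : {set n.-tuple 'I_m}) :
  P (prefix_events W) = (#|W|%:R / m%:R ^+ n)%:E.
Proof.
rewrite prefix_events_bigcup measure_fin_bigcup//; first last.
- by move=> w _; exact: measurable_cylinder.
- apply/trivIsetP => w w' _ _ /eqP ww'.
  apply/seteqP; split => // e []; rewrite /prefix_events /= !inE.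
  by move=> /eqP -> /eqP.
rewrite (eq_fsbigr (fun=> ((m%:R ^+ n)^-1)%:E)); last first.
  move=> w _.
  have := P_uniform n (fun k => [set nth (Ordinal m_gt0) w k]%SET).
  under eq_bigr do rewrite cards1 div1r.
  by rewrite prodr_const card_ord exprVn cylinderE => H; exact: H.
rewrite -(@bigfs _ _ _ _ (index_enum _) (mem W)) ?index_enum_uniq//; last first.
  by move=> w _; rewrite mem_index_enum.
by rewrite sumEFin sumr_const -[_ *+ _]mulr_natl.
Qed.

End prefix_measure.

Section bernoulli_balls.
Variables (R : realType) (beta : R) (m : nat).
Hypotheses (beta_gt1 : 1 < beta) (m_gt_beta : beta < m%:R).
Local Notation L := (expansion_length beta m).
Local Notation mu := (bernoulli_convolution beta_gt1 m_gt_beta).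

Let betaX_gt0 n : 0 < beta ^+ n.
Proof. by rewrite exprn_gt0// (lt_trans ltr01). Qed.

Let prefix_digit_sum (e : nat -> 'I_m) n :
  digit_sum beta [tuple e i | i < n] <= expansion beta e <=
  digit_sum beta [tuple e i | i < n] + L / beta ^+ n.
Proof. by apply: expansion_digit_sum => // i; rewrite tnth_mktuple. Qed.

Lemma bernoulli_ball_ge n (x r : R) : L / beta ^+ n <= r ->
  (((count_prefixes beta m n x)%:R / m%:R ^+ n)%R%:E <=
   mu `[(x - r)%R, (x + r)%R]%classic)%E.
Proof.
move=> Lr; pose m0 := digits_gt0 beta_gt1 m_gt_beta.
rewrite /count_prefixes -(prob_prefix_events (uniform_productP R m0)).
apply: le_measure; rewrite ?inE.
- exact: measurable_prefix_events.
- by rewrite -[X in measurable X]setTI; exact: measurable_funPT.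
move=> e; rewrite /prefix_events /= expansion_prefixesP// => /andP[x1 x2].
have /andP[e1 e2] := prefix_digit_sum e n.
by rewrite in_itv /= /random_expansion; apply/andP; split; lra.
Qed.

Lemma bernoulli_ball_le n (x r : R) : r <= (beta ^+ n)^-1 ->
  (mu `[(x - r)%R, (x + r)%R]%classic <=
   (#|near_words beta m n x|%:R / m%:R ^+ n)%R%:E)%E.
Proof.
move=> rn; pose m0 := digits_gt0 beta_gt1 m_gt_beta.
rewrite -(prob_prefix_events (uniform_productP R m0)).
have -> : mu `[(x - r)%R, (x + r)%R]%classic = uniform_product R m0
  (random_expansion beta_gt1 @^-1` `[(x - r)%R, (x + r)%R]%classic) by [].
apply: le_measure; rewrite ?inE.
- by rewrite -[X in measurable X]setTI; exact: measurable_funPT.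
- exact: measurable_prefix_events.
move=> e; rewrite /= in_itv /= /random_expansion => /andP[x1 x2].
rewrite /prefix_events /= inE.
have /andP[e1 e2] := prefix_digit_sum e n.
rewrite mulrDl mul1r; apply/andP; split; lra.
Qed.

End bernoulli_balls.

(** * Density points and tame points *)

Section density.
Variable R : realType.
Local Notation leb := (@lebesgue_measure R).

(** An interval of length [l * r] inside the ball of radius [r] that misses [A]
    leaves to [A] at most the proportion [1 - l / 2] of the ball. *)
Lemma density_point_meets (A : set R) (x l : R) :
  measurable A ->
  (leb (A `&` ball x r) * (leb (ball x r))^-1)%E @[r --> 0^'+] --> 1%E ->
  0 < l ->
  \forall r \near 0^'+, forall p, x - r < p -> p + l * r < x + r ->
    exists2 y, A y & p <= y <= p + l * r.
Proof.
move=> mA /fine_cvg Ax l0.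
have : 1 - l / 2 < 1 by rewrite gtrBl divr_gt0.
move=> /(cvgr_gt _ Ax) => near_r.
near=> r => p p1 p2.
apply: contrapT => noy.
have r0 : 0 < r by near: r; exact: nbhs_right_gt.
have : 1 - l / 2 < fine (leb (A `&` ball x r) * (leb (ball x r))^-1)%E.
  by near: r.
apply/negP; rewrite -leNgt.
set J := `[p, p + l * r]%classic.
have mJ : measurable J by exact: measurable_itv.
have mB : measurable (ball x r) by rewrite ball_itv; exact: measurable_itv.
have lJ : leb J = (l * r)%:E.
  rewrite lebesgue_measure_itv /= lte_fin ltrDl mulr_gt0//.
  by rewrite -EFinB addrAC subrr add0r.
have lB : leb (ball x r) = (2 * r)%:E.
  by rewrite lebesgue_measure_ball ?ltW// mulr2n; congr EFin; ring.
have mAB : measurable (A `&` ball x r) by exact: measurableI.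
have disj : (A `&` ball x r) `&` J = set0.
  apply/seteqP; split => // y [[Ay _]]; rewrite /J /= in_itv /= => pl.
  by apply: noy; exists y.
have : (leb (A `&` ball x r) + leb J <= leb (ball x r))%E.
  rewrite -measureU//; apply: le_measure; rewrite ?inE//; first exact: measurableU.
  move=> y [[]//|]; rewrite /J /= in_itv /= => /andP[y1 y2].
  by rewrite /ball /= ltr_distlC; apply/andP; split; lra.
rewrite lJ lB.
have : (0 <= leb (A `&` ball x r))%E by [].
case: (leb (A `&` ball x r)) => [v| |]//=; rewrite lee_fin => v0.
rewrite -EFinD lee_fin => vr.
have r20 : 2 * r != 0 by rewrite mulf_neq0// gt_eqF.
rewrite inver (negbTE r20) /= ler_pdivrMr ?mulr_gt0//.
have -> : (1 - l / 2) * (2 * r) = 2 * r - l * r by field.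
lra.
Unshelve. all: by end_near. Qed.

End density.

Section counting.
Variables (R : realType) (beta : R) (m : nat).

Lemma measurable_count_prefixes_le n (B : nat) : 1 < beta -> beta < m%:R ->
  measurable [set y : R | (count_prefixes beta m n y <= B)%N].
Proof.
move=> b1 bm.
pose J (w : n.-tuple 'I_m) := `[digit_sum beta w,
  digit_sum beta w + expansion_length beta m / beta ^+ n]%classic.
have mf : measurable_fun setT (fun y : R => \sum_(w : n.-tuple 'I_m) \1_(J w) y : R).
  apply: measurable_sum => w; apply: measurable_indic; exact: measurable_itv.
have /= := mf measurableT `]-oo, B%:R]%classic (measurable_itv _).
rewrite setTI; congr measurable; apply/seteqP.
have E y : \sum_(w : n.-tuple 'I_m) \1_(J w) y = (count_prefixes beta m n y)%:R :> R.
  rewrite /count_prefixes -sum1_card natr_sum [RHS]big_mkcond /=; apply: eq_bigr => w _.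
  rewrite expansion_prefixesP// indicE; case: ifP => h.
    by rewrite mem_set// /J /= in_itv.
  by rewrite memNset// /J /= in_itv /= h.
by split => y /=; rewrite in_itv /= E ler_nat.
Qed.

End counting.

Section geometric_radii.
Variable R : realType.

Lemma near_right_geometric (P : R -> Prop) (b K : R) : 1 < b -> 0 < K ->
  (\forall r \near 0^'+, P r) -> \forall n \near \oo, P (K / b ^+ n).
Proof.
move=> b1 K0 /nbhs_ballP[e /= e0 eP].
have b0 : 0 < b by exact: lt_trans b1.
have cv : K / b ^+ n @[n --> \oo] --> (0 : R).
  have -> : (fun n => K / b ^+ n) = (fun n => K * b^-1 ^+ n).
    by apply/funext => n; rewrite exprVn.
  have <- : K * 0 = 0 by rewrite mulr0.
  apply: cvgMr; apply: cvg_expr.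
  by rewrite ger0_norm ?invr_ge0 ?ltW// invf_lt1.
near=> n.
have Kn : 0 < K / b ^+ n by rewrite divr_gt0// exprn_gt0.
apply: eP => //; rewrite /ball /= sub0r normrN gtr0_norm//.
by near: n; apply: cvgr_lt; [exact: cv|].
Unshelve. all: by end_near. Qed.

End geometric_radii.

Section prefix_growth.
Variables (R : realType) (beta : R) (m : nat) (gamma : R).
Hypotheses (beta_pisot : pisot beta) (m_gt_beta : beta < m%:R).
Hypothesis gamma_gt0 : 0 < gamma.
Local Notation L := (expansion_length beta m).
Local Notation growth x :=
  (n%:R^-1 * ln (count_prefixes beta m n x)%:R @[n --> \oo] --> gamma).

Lemma count_prefixes_ge (x eps : R) : 0 < eps -> growth x ->
  \forall n \near \oo,
    expR (n%:R * (gamma - eps)) <= (count_prefixes beta m n x)%:R.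
Proof.
move=> eps0 g; have lt1 : gamma - eps < gamma by rewrite gtrBl.
near=> n; have n0 : 0 < n%:R :> R by rewrite ltr0n; near: n; exists 1%N.
have h0 : 0 < n%:R^-1 * ln (count_prefixes beta m n x)%:R :> R.
  by near: n; apply: cvgr_gt; first exact: g.
have h1 : gamma - eps < n%:R^-1 * ln (count_prefixes beta m n x)%:R.
  by near: n; apply: cvgr_gt; first exact: g.
move: h0 h1; set N := count_prefixes _ _ _ _ => h0 h1.
(* [ln 0] is [0], so a positive logarithm excludes [N = 0]. *)
have N0 : 0 < N%:R :> R.
  rewrite ltr0n lt0n; apply/negP => /eqP N0.
  by move: h0; rewrite N0 ln0// mulr0 ltxx.
rewrite -[leRHS]lnK ?posrE// ler_expR.
by move: h1; rewrite mulrC ltr_pdivlMr// mulrC => /ltW.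
Unshelve. all: by end_near. Qed.

Lemma count_prefixes_le (x eps : R) : 0 < eps -> growth x ->
  \forall n \near \oo,
    (count_prefixes beta m n x <= Num.truncn (expR (n%:R * (gamma + eps))))%N.
Proof.
move=> eps0 g; have lt1 : gamma < gamma + eps by rewrite ltrDl.
near=> n; have n0 : 0 < n%:R :> R by rewrite ltr0n; near: n; exists 1%N.
have h1 : n%:R^-1 * ln (count_prefixes beta m n x)%:R < gamma + eps.
  by near: n; apply: cvgr_lt; first exact: g.
move: h1; set N := count_prefixes _ _ _ _ => h1.
rewrite truncn_ge_nat ?expR_ge0//.
have [->|N0] := posnP N; first by rewrite expR_ge0.
rewrite -[leLHS]lnK ?posrE ?ltr0n// ler_expR.
by move: h1; rewrite mulrC ltr_pdivrMr// mulrC => /ltW.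
Unshelve. all: by end_near. Qed.

(** The growth hypothesis puts almost every point of the expansion interval in
    some [tame_points eps n0].  Rounding the bound down to a natural number turns
    it into a hypothesis of [card_near_words]. *)
Definition tame_points (eps : R) (n0 : nat) : set R :=
  \bigcap_n [set y | (count_prefixes beta m (n0 + n) y <=
    Num.truncn (expR ((n0 + n)%:R * (gamma + eps))))%N].

Lemma measurable_tame_points eps n0 : measurable (tame_points eps n0).
Proof.
apply: bigcapT_measurable => n; apply: measurable_count_prefixes_le => //.
exact: pisot_gt1.
Qed.

(** At a density point [x] of a set of tame points, each interval
    [[S(w), S(w) + L / beta ^ n]] with [w] near [x] contains a tame point, which
    bounds the number of words with digit sum [S(w)]. *)
Lemma near_words_growth :
  {ae lebesgue_measure, forall x : R, expansion_interval beta m x -> growth x} ->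
  exists k : nat, {ae lebesgue_measure, forall x : R,
    expansion_interval beta m x -> forall eps, 0 < eps ->
    \forall n \near \oo,
      #|near_words beta m n x|%:R <= k%:R * expR (n%:R * (gamma + eps))}.
Proof.
move=> ae_growth.
have [k kP] := card_near_words beta_pisot m_gt_beta.
exists k.
have b1 := pisot_gt1 beta_pisot.
have b0 : 0 < beta by exact: lt_trans b1.
(* Only countably many [eps] are used, so that one null set serves for all. *)
have ae_density : {ae lebesgue_measure, forall x : R, forall j n0 : nat,
   (lebesgue_measure (tame_points j.+1%:R^-1 n0 `&` ball x r) *
    (lebesgue_measure (ball x r))^-1)%E @[r --> 0^'+]
      --> (\1_(tame_points j.+1%:R^-1 n0) x)%:E}.
  apply: ae_foralln => j; apply: ae_foralln => n0.
  exact: lebesgue_density (measurable_tame_points _ _).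
move: ae_growth ae_density.
apply: (@filterS2 _ _ (ae_filter_ringOfSetsType lebesgue_measure)).
move=> x gx dx xI eps eps0.
have {}gx := gx xI.
pose j := Num.truncn eps^-1; pose epsj : R := j.+1%:R^-1.
have epsj0 : 0 < epsj by rewrite invr_gt0.
have epsj_le : epsj <= eps.
  by rewrite -[leRHS]invrK lef_pV2 ?posrE ?invr_gt0// ltW// truncnS_gt.
have [n0 _ n0P] := count_prefixes_le epsj0 gx.
have xG : tame_points epsj n0 x by move=> n _ /=; apply: n0P; exact: leq_addr.
have := dx j n0; rewrite indicE mem_set//= => dxG.
have L1 := expansion_length_gt1 b1 m_gt_beta.
(* All the intervals in play lie in the ball of radius [K / beta ^ n]. *)
pose K := L + 2; have K0 : 0 < K by rewrite /K; lra.
have LK0 : 0 < L / K by rewrite divr_gt0//; lra.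
have := density_point_meets (measurable_tame_points _ _) dxG LK0.
move/(near_right_geometric b1 K0) => near_meet.
near=> n.
have meet : forall p, x - K / beta ^+ n < p ->
    p + L / K * (K / beta ^+ n) < x + K / beta ^+ n ->
    exists2 y, tame_points epsj n0 y & p <= y <= p + L / K * (K / beta ^+ n).
  by near: n.
have LKE : L / K * (K / beta ^+ n) = L / beta ^+ n.
  by field; rewrite !gt_eqF// exprn_gt0.
rewrite LKE in meet.
have bn : 0 < (beta ^+ n)^-1 by rewrite invr_gt0 exprn_gt0.
have n0n : (n0 <= n)%N by near: n; exists n0.
have : (#|near_words beta m n x| <=
    k * Num.truncn (expR (n%:R * (gamma + epsj))))%N.
  apply: kP => w; rewrite inE => /andP[w1 w2].
  rewrite mulrDl mul1r in w1.
  have [||y yG yw] := meet (digit_sum beta w).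
  - by rewrite /K mulrDl; lra.
  - by rewrite /K mulrDl; lra.
  - exists y => //; have := yG (n - n0)%N Logic.I.
    by rewrite /= subnKC.
rewrite -(ler_nat R) natrM => /le_trans; apply.
rewrite ler_wpM2l// (@le_trans _ _ (expR (n%:R * (gamma + epsj))))//.
  by rewrite truncn_le expR_ge0.
rewrite ler_expR.
by rewrite ler_wpM2l// lerD2l.
Unshelve. all: by end_near. Qed.

End prefix_growth.

(** * Local dimension *)

Section local_dimension_criterion.
Variable R : realType.

(** An error that is bounded, or small relative to [ln r], disappears in the
    quotient, because [ln r] tends to [-oo]. *)
Lemma cvg_ln_ratio (f : R -> R) (d : R) :
  (forall eps : R, 0 < eps -> exists C : R, \forall r \near 0^'+,
    `|ln (f r) - d * ln r| <= - (eps * ln r) + C) ->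
  ln (f r) * (ln r)^-1 @[r --> 0^'+] --> d.
Proof.
move=> H; apply/cvgrPdist_le => eps eps0.
have [C HC] := H (eps / 2) (divr_gt0 eps0 (ltr0n _ 2)).
pose K := 2 * `|C| / eps + 1.
near=> r.
have r0 : 0 < r by near: r; exact: nbhs_right_gt.
have rK : ln r < - K.
  rewrite -ltr_expR lnK ?posrE//; near: r; apply: nbhs_right_lt; exact: expR_gt0.
have K1 : 1 <= K by rewrite lerDr divr_ge0 ?mulr_ge0// ltW.
have lr : ln r < 0 by lra.
have -> : d - ln (f r) * (ln r)^-1 = (d * ln r - ln (f r)) / ln r.
  by field; rewrite lt_eqF.
rewrite normrM normfV ler_pdivrMr ?normr_gt0 ?lt_eqF// distrC (ltr0_norm lr).
have : `|ln (f r) - d * ln r| <= - (eps / 2 * ln r) + C by near: r.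
move=> /le_trans; apply.
have CK : `|C| <= eps / 2 * K.
  rewrite /K mulrDr mulr1; have -> : eps / 2 * (2 * `|C| / eps) = `|C|.
    by field; rewrite gt_eqF.
  by rewrite lerDl divr_ge0// ltW.
have := ler_norm C.
have : eps / 2 * K <= eps / 2 * - ln r by rewrite ler_pM2l ?divr_gt0//; lra.
lra.
Unshelve. all: by end_near. Qed.

End local_dimension_criterion.

(** The exponent [n] is the one with [b ^ -(n + 1) < r <= b ^ -n]. *)
Lemma near_scale_of_radius (R : realType) (b : R) (N : nat) : 1 < b ->
  \forall r \near 0^'+, 0 < r /\ exists n, [/\ (N <= n)%N, r <= (b ^+ n)^-1 &
    - ln r < n.+1%:R * ln b].
Proof.
move=> b1; have lb : 0 < ln b by rewrite ln_gt0.
have b0 : 0 < b by exact: lt_trans b1.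
near=> r.
have r0 : 0 < r by near: r; exact: nbhs_right_gt.
have r1 : r < 1 by near: r; exact: nbhs_right_lt.
have rN : r < expR (- (N%:R * ln b)).
  by near: r; apply: nbhs_right_lt; exact: expR_gt0.
rewrite -[ltLHS]lnK ?posrE// ltr_expR ltrNr in rN.
have t0 : 0 <= - ln r / ln b.
  by rewrite divr_ge0 ?oppr_ge0 ?(ltW lb)// ltW// ln_lt0// r0.
have /andP[n1 n2] := truncn_itv t0.
split=> //; exists (Num.truncn (- ln r / ln b)); split.
- by rewrite truncn_ge_nat// ler_pdivlMr// ltW.
- move: n1; rewrite ler_pdivlMr// lerNr => n1.
  rewrite -ler_ln ?posrE ?invr_gt0 ?exprn_gt0//.
  by rewrite lnV ?posrE ?exprn_gt0// lnXn// -mulr_natl.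
- by rewrite -ltr_pdivrMr.
Unshelve. all: by end_near. Qed.

Lemma ln_growth_rate (R : realType) (K g b : R) (n : nat) : 0 < K -> 0 < b ->
  ln (K * expR (n%:R * g) / b ^+ n) = ln K - n%:R * (ln b - g).
Proof.
move=> K0 b0; rewrite ln_div ?posrE ?exprn_gt0// ?mulr_gt0 ?expR_gt0//.
by rewrite lnM ?posrE ?expR_gt0// expRK lnXn// -mulr_natl; ring.
Qed.

(** Here [s] is [- ln r], [lf] the logarithm of the mass of the ball and [delta]
    the value of [ln m - gamma].  The upper bound on the mass is taken at the
    scale [n], the lower bound at the finer scale [n + q]; replacing both [n] and
    [n + q] by the real number [s / lb] costs a bounded error. *)
Lemma ln_mass_error (R : realType) (delta eps lk lb s : R) (n q : nat) (lf : R) :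
  0 < eps -> 0 < lb -> 0 <= lk ->
  n%:R * lb <= s -> s < n.+1%:R * lb ->
  lf <= lk - n%:R * (delta - eps) ->
  - ((n + q)%:R * (delta + eps)) <= lf ->
  `|lf + delta * (s / lb)| <=
    eps / lb * s + (lk + `|delta| * q.+1%:R + eps * q%:R).
Proof.
move=> eps0 lb0 lk0 ns sn lf1 lf2.
set t := s / lb.
have nt : n%:R <= t by rewrite ler_pdivlMr.
have tn : t < n%:R + 1 by rewrite natr1 ltr_pdivrMr.
have -> : eps / lb * s = eps * t by rewrite /t; ring.
have n0 : 0 <= n%:R :> R by [].
have q0 : 0 <= q%:R :> R by [].
rewrite natrD in lf2; rewrite -natr1.
have e1 : eps * n%:R <= eps * t by rewrite ler_pM2l.
have d1 : delta * (t - n%:R) <= `|delta| * (q%:R + 1).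
  apply: (le_trans (ler_norm _)); rewrite normrM ler_wpM2l//.
  by rewrite ger0_norm; lra.
have d2 : delta * (n%:R + q%:R - t) <= `|delta| * (q%:R + 1).
  apply: (le_trans (ler_norm _)); rewrite normrM ler_wpM2l//.
  by rewrite ler_norml; apply/andP; split; lra.
have eq0 : 0 <= eps * q%:R by rewrite mulr_ge0// ltW.
by rewrite ler_norml; apply/andP; split; lra.
Qed.

Unset Implicit Arguments.
Set Strict Implicit.
Set Printing Implicit Defensive.

Theorem corollary1p2 (R : realType) (beta : R) (m : nat) (gamma : R)
    (beta_pisot : pisot beta) (m_gt_beta : beta < m%:R)
    (gamma_gt0 : 0 < gamma)
    (gamma_growth : {ae lebesgue_measure, forall x : R,
       expansion_interval beta m x ->
       n%:R^-1 * ln (count_prefixes beta m n x)%:R @[n --> \oo] --> gamma}) :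
  {ae lebesgue_measure, forall x : R,
    expansion_interval beta m x ->
    has_local_dimension
      (bernoulli_convolution (pisot_gt1 beta_pisot) m_gt_beta) x
      ((ln m%:R - gamma) / ln beta)%:E}.
Proof.
have [k near_growth] := near_words_growth beta_pisot m_gt_beta gamma_growth.
move: gamma_growth near_growth.
apply: (@filterS2 _ _ (ae_filter_ringOfSetsType lebesgue_measure)) => x gx kx xI.
have {}gx := gx xI; have {}kx := kx xI.
have b1 := pisot_gt1 beta_pisot; have b0 : 0 < beta by exact: lt_trans b1.
have lb : 0 < ln beta by rewrite ln_gt0.
have m0 : 0 < m%:R :> R by exact: lt_trans m_gt_beta.
have L1 := expansion_length_gt1 b1 m_gt_beta.
set L := expansion_length beta m in L1.
have L0 : 0 < L by exact: lt_trans L1.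
rewrite /has_local_dimension; set mu := bernoulli_convolution _ _.
pose f (r : R) : R := fine (mu `[x - r, x + r]%classic).
have muE r : mu `[x - r, x + r]%classic = (f r)%:E.
  by rewrite /f fineK// fin_num_measure//; exact: measurable_itv.
(* At the scale [n + q], a cylinder is shorter than [beta ^ -(n + 1)]. *)
pose q := (Num.truncn (ln L / ln beta)).+2.
have qP : ln L <= (q%:R - 1) * ln beta.
  rewrite -natr1 addrK -ler_pdivrMr// ltW//.
  by have /andP[] := @truncn_itv R (ln L / ln beta) (divr_ge0 (ln_ge0 (ltW L1)) (ltW lb)).
(* The upper bound counts the words near [x], the lower bound only the prefixes
   of expansions of [x]; [k.+1] replaces [k] to have a positive argument of the
   logarithm. *)
have est eps : 0 < eps -> exists N, forall n r, (N <= n)%N -> 0 < r ->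
    r <= (beta ^+ n)^-1 -> - ln r < n.+1%:R * ln beta ->
    [/\ 0 < f r,
      ln (f r) <= ln (k.+1%:R) - n%:R * (ln m%:R - gamma - eps) &
      - ((n + q)%:R * (ln m%:R - gamma + eps)) <= ln (f r)].
  move=> eps0; have [N1 _ N1P] := kx _ eps0.
  have [N2 _ N2P] := count_prefixes_ge gamma_gt0 eps0 gx.
  exists (maxn N1 N2) => n r; rewrite geq_max => /andP[nN1 nN2] r0 rn nr.
  have Lr : L / beta ^+ (n + q) <= r.
    have Lbq : 0 < L / beta ^+ (n + q) by exact: divr_gt0 L0 (exprn_gt0 _ b0).
    rewrite -ler_ln ?posrE// ln_div ?posrE ?exprn_gt0// lnXn// -mulr_natl.
    move: nr; rewrite ltrNl => /ltW; apply: le_trans.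
    rewrite lerBlDr (le_trans qP)// -mulNr -mulrDl ler_wpM2r ?(ltW lb)//.
    by have -> : q%:R - 1 = - n.+1%:R + (n + q)%:R :> R by rewrite natrD -natr1; ring.
  have f_ge : expR ((n + q)%:R * (gamma - eps)) / m%:R ^+ (n + q) <= f r.
    have := bernoulli_ball_ge (pisot_gt1 beta_pisot) m_gt_beta x Lr.
    rewrite -/mu muE lee_fin; apply: le_trans.
    rewrite ler_pM2r ?invr_gt0 ?exprn_gt0//.
    by apply: N2P => /=; exact: leq_trans (leq_addr _ _).
  have f0 : 0 < f r.
    by apply: lt_le_trans f_ge; rewrite divr_gt0 ?expR_gt0// exprn_gt0.
  have f_le : f r <= k.+1%:R * expR (n%:R * (gamma + eps)) / m%:R ^+ n.
    have := bernoulli_ball_le (pisot_gt1 beta_pisot) m_gt_beta x rn.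
    rewrite -/mu muE lee_fin => /le_trans; apply.
    rewrite ler_pM2r ?invr_gt0 ?exprn_gt0//.
    rewrite (le_trans (N1P _ _))//.
    by rewrite ler_pM2r ?expR_gt0// ler_nat.
  split => //.
    rewrite -ler_ln ?posrE// in f_le; last first.
      by rewrite divr_gt0 ?exprn_gt0// mulr_gt0 ?expR_gt0.
    by move: f_le; rewrite ln_growth_rate// opprD addrA.
  rewrite -ler_ln ?posrE// in f_ge; last first.
    by rewrite divr_gt0 ?exprn_gt0// expR_gt0.
  by move: f_ge; rewrite -[expR _]mul1r ln_growth_rate// ln1 sub0r opprD opprK addrA.
have f_pos : \forall r \near 0^'+, 0 < f r.
  have [N NP] := est 1 ltr01.
  near=> r.
  suff [r0 [n [nN rn nr]]] : 0 < r /\ exists n, [/\ (N <= n)%N,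
      r <= (beta ^+ n)^-1 & - ln r < n.+1%:R * ln beta].
    by have [] := NP n r nN r0 rn nr.
  by near: r; exact: near_scale_of_radius.
have lim : ln (f r) * (ln r)^-1 @[r --> 0^'+] --> (ln m%:R - gamma) / ln beta.
  apply: cvg_ln_ratio => eps eps0.
  have eb0 : 0 < eps * ln beta by exact: mulr_gt0.
  have [N NP] := est _ eb0.
  exists (ln k.+1%:R + `|ln m%:R - gamma| * q.+1%:R + eps * ln beta * q%:R).
  near=> r.
  suff [r0 [n [nN rn nr]]] : 0 < r /\ exists n, [/\ (N <= n)%N,
      r <= (beta ^+ n)^-1 & - ln r < n.+1%:R * ln beta].
    have [f0 f1 f2] := NP n r nN r0 rn nr.
    have nr' : n%:R * ln beta <= - ln r.
      move: rn; rewrite -ler_ln ?posrE ?invr_gt0 ?exprn_gt0//.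
      by rewrite lnV ?posrE ?exprn_gt0// lnXn// -(mulr_natl (ln beta)) lerNr.
    have k1 : 0 <= ln k.+1%:R :> R by rewrite ln_ge0// ler1n.
    have := ln_mass_error eb0 lb k1 nr' nr f1 f2.
    have -> : eps * ln beta / ln beta * - ln r = - (eps * ln r).
      by field; rewrite gt_eqF.
    have -> // : ln (f r) + (ln m%:R - gamma) * (- ln r / ln beta) =
       ln (f r) - (ln m%:R - gamma) / ln beta * ln r by field; rewrite gt_eqF.
  by near: r; exact: near_scale_of_radius.
apply/fine_cvgP; split.
  near=> r; rewrite /= muE lne_EFin//; by near: r.
apply: cvg_trans lim; apply: near_eq_cvg; near=> r.
by rewrite /= muE lne_EFin//; near: r.
Unshelve. all: by end_near. Qed.
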